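(* There exist a strictly convex increasing sequence $(a_m)_{m\geq 1}$ of positive integers and a function $f\in L^1(\mathbb T)$ such that (a) $a_m\leq 7m^8$ for every $m\geq 1$; (b) $0$ is a Lebesgue point of $f$ and $f(0)=0$; (c) $$\sup_{m\geq 1}\left|\frac{1}{m}\sum_{k=1}^m S_{a_k}f(0)\right|=\infty.$$
   Context: $\mathbb T=[-\pi,\pi)$, and functions on $\mathbb T$ are regarded as $2\pi$-periodic functions on $\mathbb R$. A function $f\in L^1(\mathbb T)$ is here an integrable function with a specified value at each point (in particular, $f(0)$ is meaningful). For $f\in L^1(\mathbb T)$, $S_nf(x)$ denotes the $n$th partial sum of the Fourier series of $f$ at $x$, that is, $$S_nf(x)=\frac{1}{2\pi}\int_{-\pi}^{\pi}f(x+t)D_n(t)\,dt,\qquad D_n(t)=\frac{\sin((n+1/2)t)}{\sin(t/2)}$$ (with $D_n(0)=2n+1$). A point $x\in\mathbb T$ is a Lebesgue point of $f$ if $$\lim_{h\to 0+}\frac{1}{2h}\int_{x-h}^{x+h}|f(t)-f(x)|\,dt=0.$$ A sequence $(a_m)_{m\ge 1}$ is strictly convex if its differences $d_m=a_{m+1}-a_m$ satisfy $d_{m+1}>d_m$ for every $m\geq 1$. In the claim, increasing means strictly increasing: $a_{m+1}>a_m$ for every $m\ge 1$. *)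

(* Defs.v *)
From HB Require Import structures.
From mathcomp Require Import all_boot all_order all_algebra.
From mathcomp Require Import all_classical all_reals all_analysis.

Set Implicit Arguments.
Unset Strict Implicit.
Unset Printing Implicit Defensive.

Import Order.TTheory GRing.Theory Num.Theory.
Import numFieldNormedType.Exports.

Local Open Scope classical_set_scope.
Local Open Scope ring_scope.

(* A function on the torus is represented by its 2 pi-periodic extension to R;
   it has a value at every point and is not an almost-everywhere class. *)
Definition L1_torus (R : realType) (f : R -> R) : Prop :=
  periodic f (pi *+ 2) /\
  (@lebesgue_measure R).-integrable `[- pi, pi[ (EFin \o f).

(* sin (t / 2) vanishes exactly at the multiples of 2 pi, where the quotient
   extends continuously by 2 n + 1; on [-pi, pi[ only t = 0 is concerned. *)
Definition dirichlet_kernel (R : realType) (n : nat) (t : R) : R :=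
  if sin (t / 2) == 0 then (2 * n + 1)%:R
  else sin ((n%:R + 2^-1) * t) / sin (t / 2).

Definition fourier_partial_sum (R : realType) (n : nat) (f : R -> R) (x : R)
    : R :=
  (2 * pi)^-1 *
  \int[@lebesgue_measure R]_(t in `[- pi, pi]) (f (x + t) * dirichlet_kernel n t).

(* Sequences (a_m)_{m >= 1} are functions on nat whose value at 0 is
   irrelevant. *)
Definition strictly_increasing (a : nat -> nat) : Prop :=
  forall m : nat, (1 <= m)%N -> (a m < a m.+1)%N.

Definition difference (a : nat -> nat) (m : nat) : int :=
  (a m.+1)%:Z - (a m)%:Z.

Definition strictly_convex (a : nat -> nat) : Prop :=
  forall m : nat, (1 <= m)%N -> difference a m < difference a m.+1.

(* Main.v *)
Require Import Defs.
From mathcomp Require Import all_boot all_order all_algebra.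
From mathcomp Require Import all_classical all_reals all_analysis.
From mathcomp Require Import measurable_realfun zify ring lra.
Import Order.TTheory GRing.Theory Num.Theory.
Import numFieldNormedType.Exports.

(** Put nu_k := a_k + 1/2. If 2 a_k + 1 = 5 ^ L * (4 c + 1), then
    sin (nu_k * pi / 5 ^ x) = 1 for every x <= L, because 5 = 1 mod 4. A greedy
    choice of a_k achieves this with 5 ^ L of order k while keeping the
    differences strictly increasing and a_k = O(k ^ 3). The function f is
    sin (t / 2) times a sum of indicators of intervals centred at
    t_i = pi / 5 ^ (4 ^ (i + 1)), with radius t_(2 i + 1) and total mass of
    order (i + 1) ^ (-1/2); since the masses tend to 0, the origin is a Lebesgue
    point. The factor sin (t / 2) cancels the denominator of the Dirichlet
    kernel, and the integral of sin (nu t) over the i-th interval is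
    2 / nu * sin (nu * t_i) * sin (nu * t_(2 i + 1)). If J nodes satisfy
    sin (nu_k * t_i) = 1, then nu_k * t_i is at most pi / 4 for i > J, so only the
    one or two terms involving t_J can be negative, and they are bounded, while
    each i with J / 2 <= i < J contributes a multiple of J ^ (-1/2). Thus
    S_(a_k) f(0) >= c * J ^ (1/2) - C with J tending to infinity with k, and the
    Cesaro means are unbounded. *)

Set Implicit Arguments.
Unset Strict Implicit.
Unset Printing Implicit Defensive.

(** * The sequence *)

Definition modulus (k : nat) : nat := 5 ^ trunc_log 5 k.

(** Since q = [modulus k] is odd, [q./2] is (q - 1) / 2, so the value x satisfies 2 x + 1 = q (4 c +
    1) with c the successor of the quotient. Taking x above [a + d] makes the new difference exceed
    [d]. *)
Definition next_term (a d k : nat) : nat :=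
  (modulus k)./2 + 2 * modulus k * ((a + d) %/ (2 * modulus k)).+1.

(* The pair consists of the k-th term and its difference with the previous one. *)
Fixpoint sparse_state (k : nat) : nat * nat :=
  if k is k'.+1 then
    let x := next_term (sparse_state k').1 (sparse_state k').2 k in
    (x, x - (sparse_state k').1)
  else (0, 0).

Definition sparse_seq (k : nat) : nat := (sparse_state k).1.

Definition sparse_step (k : nat) : nat := (sparse_state k).2.

Lemma modulus_gt0 k : 0 < modulus k.
Proof. by rewrite expn_gt0. Qed.

Lemma modulus_le k : 0 < k -> modulus k <= k.
Proof. exact: trunc_logP. Qed.

Lemma next_term_gt a d k : a + d < next_term a d k.
Proof.
rewrite /next_term; have := modulus_gt0 k; move: (modulus k) => q q0.
have := ltn_ceil (a + d) (_ : 0 < 2 * q); nia.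
Qed.

Lemma next_term_le a d k : 0 < k -> next_term a d k <= a + d + 3 * k.
Proof.
move=> /modulus_le; rewrite /next_term; move: (modulus k) => q qk.
have := leq_divM (a + d) (2 * q); lia.
Qed.

Lemma sparse_seqS k :
  sparse_seq k.+1 = next_term (sparse_seq k) (sparse_step k) k.+1.
Proof. by []. Qed.

Lemma sparse_stepS k : sparse_step k.+1 = sparse_seq k.+1 - sparse_seq k.
Proof. by []. Qed.

Lemma sparse_seq_gt k : sparse_seq k + sparse_step k < sparse_seq k.+1.
Proof. by rewrite sparse_seqS next_term_gt. Qed.

Lemma sparse_stepE k : sparse_seq k + sparse_step k.+1 = sparse_seq k.+1.
Proof. by rewrite sparse_stepS; have := sparse_seq_gt k; lia. Qed.

Lemma sparse_seq_ltS k : sparse_seq k < sparse_seq k.+1.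
Proof. by have := sparse_seq_gt k; lia. Qed.

Lemma sparse_step_ltS k : sparse_step k < sparse_step k.+1.
Proof. by have := sparse_seq_gt k; have := sparse_stepE k; lia. Qed.

Lemma sparse_step_le k : sparse_step k <= 3 * k ^ 2.
Proof.
elim: k => [//|k IH].
have := next_term_le (sparse_seq k) (sparse_step k) (ltn0Sn k).
have := sparse_stepE k; rewrite sparse_seqS; case: k IH => [|k]; nia.
Qed.

Lemma sparse_seq_le k : sparse_seq k <= 3 * k ^ 3.
Proof.
elim: k => [//|k IH]; rewrite -sparse_stepE.
have := sparse_step_le k.+1; rewrite !expnS !expn0 in IH *; nia.
Qed.

Lemma expn5_mod4 n : exists c, 5 ^ n = 4 * c + 1.
Proof. by elim: n => [|n [c IH]]; [exists 0|exists (5 * c + 1); rewrite expnS IH; lia]. Qed.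

Lemma sparse_seq_modulus k : 0 < k ->
  exists c, 2 * sparse_seq k + 1 = modulus k * (4 * c + 1).
Proof.
case: k => // k _; rewrite sparse_seqS /next_term.
set c := (_ %/ _).+1; exists c; rewrite /modulus.
by have [b ->] := expn5_mod4 (trunc_log 5 k.+1); nia.
Qed.

(* The number of [i] for which [5 ^ (4 ^ i.+1)] divides [modulus k] *)
Definition level (k : nat) : nat := trunc_log 4 (trunc_log 5 k).

Lemma sparse_seq_low k i : i < level k ->
  exists c, 2 * sparse_seq k + 1 = 5 ^ (4 ^ i.+1) * (4 * c + 1).
Proof.
rewrite /level => ik; have L0 : 0 < trunc_log 5 k.
  by case: (trunc_log 5 k) ik => //; rewrite trunc_log0.
have k0 : 0 < k by case: k L0 {ik}; rewrite ?trunc_log0.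
have [c ->] := sparse_seq_modulus k0; rewrite /modulus.
have iL : 4 ^ i.+1 <= trunc_log 5 k.
  by apply: leq_trans (trunc_logP (isT : 1 < 4) L0); rewrite leq_exp2l.
(* The remaining power of 5 is 1 mod 4, so multiplying it into the cofactor preserves the form
   [4 * c + 1]. *)
rewrite -(subnKC iL) expnD -mulnA; have [b ->] := expn5_mod4 (trunc_log 5 k - 4 ^ i.+1).
by exists (4 * b * c + b + c); congr (_ * _); lia.
Qed.

(** The exponents [4 ^ i] outrun the cubic growth of the sequence: 2 (2 a_k + 1) <= 14 k ^ 3 <= 5 ^
    (2 + 3 (L + 1)), and both L + 1 and 2 are at most [4 ^ i], so this exponent is at most
    [4 ^ i.+1]. *)
Lemma sparse_seq_high k i : 0 < k -> level k < i ->
  2 * (2 * sparse_seq k + 1) <= 5 ^ (4 ^ i.+1).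
Proof.
move=> k0 ki; set L := trunc_log 5 k.
have kL : k <= 5 ^ L.+1 by apply/ltnW/trunc_log_ltn.
have Li : L.+1 <= 4 ^ i.
  by apply: (@leq_trans (4 ^ (level k).+1)); [exact: trunc_log_ltn|rewrite leq_exp2l].
have i2 : 2 <= 4 ^ i by rewrite (@leq_trans (4 ^ 1))// leq_exp2l//; lia.
apply: (@leq_trans (5 ^ (2 + L.+1 * 3))); last by rewrite leq_exp2l// expnS; lia.
rewrite expnD expnM; have a_le := sparse_seq_le k.
have k3 : 0 < k ^ 3 by rewrite expn_gt0 k0.
have kL3 : k ^ 3 <= (5 ^ L.+1) ^ 3 by rewrite leq_exp2r.
by move: (_ ^ 3) (k ^ 3) kL3 k3 a_le => u v; lia.
Qed.

Lemma level_expn n k : 5 ^ 4 ^ n <= k -> n <= level k.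
Proof.
by move=> nk; apply: trunc_log_max => //; apply: trunc_log_max.
Qed.

Local Open Scope classical_set_scope.
Local Open Scope ring_scope.

(** * Trigonometric estimates *)

Section trigonometry.
Context {R : realType}.
Implicit Types x y nu : R.

Lemma sin_MVT x : 0 <= x -> exists2 y, y \in `[0, x] & sin x = cos y * x.
Proof.
move=> x0; have [y yx] := MVT_segment x0 (fun z _ => is_derive_sin z)
  (continuous_subspaceT (@continuous_sin R)).
by rewrite sin0 !subr0; exists y.
Qed.

Lemma sin_le_id x : 0 <= x -> `|sin x| <= x.
Proof.
move=> x0; have [y _ ->] := sin_MVT x0.
by rewrite normrM (ger0_norm x0) ler_piMl// cos_max.
Qed.

(** As 2 x <= pi / 2, the double angle formula gives 2 cos(x) ^ 2 - 1 >= 0. *)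
Lemma cos_ge_half x : 0 <= x <= pi / 4 -> 2^-1 <= cos x.
Proof.
move=> /andP[x0 xpi].
have c0 : 0 <= cos x.
  by apply: cos_ge0_pihalf; have := @pi_ge0 R => p0; apply/andP; split; lra.
have : 0 <= cos (x *+ 2).
  by apply: cos_ge0_pihalf; have := @pi_ge0 R => p0; rewrite -mulr_natr; apply/andP; split; lra.
rewrite cos_mulr2n; nra.
Qed.

Lemma sin_ge_half x : 0 <= x <= pi / 4 -> x / 2 <= sin x.
Proof.
move=> /andP[x0 xpi]; have [y + ->] := sin_MVT x0.
rewrite in_itv/= => /andP[y0 yx].
have : 2^-1 <= cos y by apply: cos_ge_half; rewrite y0 (le_trans yx).
by rewrite mulrC => ?; exact: ler_wpM2r.
Qed.

Lemma sin_pihalf_4n1 (n : nat) : sin (pi / 2 * (4 * n + 1)%:R) = 1 :> R.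
Proof.
have -> : pi / 2 * (4 * n + 1)%:R = pi / 2 + (pi *+ 2) *+ n :> R.
  by rewrite -mulrnA -[pi *+ _]mulr_natr natrD !natrM; field.
by rewrite (periodicn (@sinD2pi R)) sin_pihalf.
Qed.

Lemma integral_sin nu (a b : R) : 0 < nu -> a < b ->
  (\int[lebesgue_measure]_(t in `[a, b]) (sin (nu * t)%R)%:E =
   (nu^-1 * (cos (nu * a) - cos (nu * b)))%:E)%E.
Proof.
move=> nu0 ab; pose F (t : R) := - (nu^-1 * cos (nu * t)).
have dF (t : R) : is_derive t 1 F (sin (nu * t)).
  rewrite /F; apply: is_derive_eq; rewrite /GRing.scale/=.
  by field; rewrite gt_eqF.
rewrite (@continuous_FTC2 _ _ F)//.
- by rewrite /F -EFinB; congr EFin; ring.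
- apply: derivable_within_continuous => t _.
  by apply: ex_derive.
- split.
  + by move=> t _; apply: ex_derive.
  + apply: cvg_at_right_filter; apply: differentiable_continuous.
    by apply/derivable1_diffP; apply: ex_derive.
  + apply: cvg_at_left_filter; apply: differentiable_continuous.
    by apply/derivable1_diffP; apply: ex_derive.
- by move=> t _; rewrite derive1E; apply: derive_val.
Qed.

Lemma integral_sin_sym nu (a d : R) : 0 < nu -> 0 < d ->
  (\int[lebesgue_measure]_(t in `[(a - d)%R, (a + d)%R]) (sin (nu * t)%R)%:E =
   (2 / nu * (sin (nu * a) * sin (nu * d)))%:E)%E.
Proof.
move=> nu0 d0; rewrite integral_sin//; last lra.
by rewrite (mulrBr nu) (mulrDr nu) cosB cosD; congr EFin; ring.
Qed.

End trigonometry.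

(** * Nodes: geometric decay and values of the sine *)

Section nodes.
Context {R : realType}.
Implicit Types (i j n : nat) (h t nu : R).

Definition node i : R := pi / (5 ^ (4 ^ i.+1))%:R.

Lemma node_gt0 i : 0 < node i.
Proof. by rewrite divr_gt0 ?pi_gt0// ltr0n expn_gt0. Qed.

Lemma node_halve i : node i.+1 <= node i / 2.
Proof.
rewrite /node -mulrA ler_pM2l ?pi_gt0// -invfM lef_pV2 ?posrE ?mulr_gt0 ?ltr0n ?expn_gt0//.
rewrite -natrM ler_nat (@leq_trans (5 ^ (4 ^ i.+1).+1))//.
  by rewrite [leqRHS]expnS mulnC leq_mul2r orbT.
by rewrite leq_exp2l// ltn_exp2l.
Qed.

Lemma node_lt_half i j : (i < j)%N -> node j <= node i / 2.
Proof.
elim: j => // j IH; rewrite ltnS leq_eqVlt => /predU1P[->|/IH ij].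
  exact: node_halve.
by have := node_halve j; have := node_gt0 j; lra.
Qed.

Lemma node_le i j : (i <= j)%N -> node j <= node i.
Proof.
rewrite leq_eqVlt => /predU1P[->//|/node_lt_half].
by have := node_gt0 i; lra.
Qed.

Lemma node0_le : node 0 <= 1 / 4.
Proof.
rewrite ler_pdivrMr ?ltr0n ?expn_gt0//; have := @pihalf_lt2 R => h.
by rewrite (@le_trans _ _ 4)//; lra.
Qed.

Lemma node_cvg0 t : 0 < t -> exists i, node i < t.
Proof.
move=> t0; have half i : node i <= (2 ^ i)%:R^-1.
  elim: i => [|i IH]; first by rewrite invr1 (le_trans node0_le)//; lra.
  by rewrite expnS natrM invfM; have := node_halve i; lra.
exists (Num.bound t^-1); apply: le_lt_trans (half _) _.
rewrite invf_plt ?posrE ?ltr0n ?expn_gt0//.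
apply: lt_trans (_ : (Num.bound t^-1)%:R < _); last by rewrite ltr_nat ltn_expl.
by rewrite archi_boundP// invr_ge0 ltW.
Qed.

Lemma sum_node_lt h n : 0 <= h -> \sum_(i < n | node i < h) node i <= 2 * h.
Proof.
(* Strengthening for the induction: halving gives [node n <= 2 * (node n - node n.+1)], so the sum
   telescopes. *)
move=> h0; suff : \sum_(i < n | node i < h) node i <=
    2 * (h - Num.min (node n) h).
  have : 0 <= Num.min (node n) h by rewrite le_min ltW// node_gt0.
  lra.
elim: n => [|n IH].
  rewrite big_ord0; have : Num.min (node 0) h <= h by rewrite ge_min lexx orbT.
  by lra.
rewrite big_mkcond big_ord_recr/= -big_mkcond/=; apply: le_trans (lerD IH (lexx _)) _.
have := node_halve n; have := node_gt0 n.
case: (ltP (node n) h) => nh; case: (ltP (node n.+1) h) => nh1; lra.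
Qed.

Lemma sin_node_low k i : (i < level k)%N ->
  sin (((sparse_seq k)%:R + 2^-1) * node i) = 1.
Proof.
move=> /sparse_seq_low[c cE]; apply: etrans (sin_pihalf_4n1 c); rewrite /node; congr sin.
have := congr1 (fun m : nat => m%:R : R) cE; rewrite natrD 2!natrM.
have : (5 ^ 4 ^ i.+1)%:R != 0 :> R by rewrite pnatr_eq0 expn_eq0.
move: (_ ^ _)%:R (4 * c + 1)%:R => q r q0 aq.
have -> : (sparse_seq k)%:R + 2^-1 = q * r / 2 :> R by lra.
by field.
Qed.

Lemma node_high k i : (0 < k)%N -> (level k < i)%N ->
  ((sparse_seq k)%:R + 2^-1) * node i <= pi / 4.
Proof.
move=> k0 ki; have := sparse_seq_high k0 ki; rewrite -(ler_nat R) !natrM natrD.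
have q0 : 0 < (5 ^ 4 ^ i.+1)%:R :> R by rewrite ltr0n expn_gt0.
rewrite /node; move: (_ ^ _)%:R q0 => q q0 aq.
rewrite mulrCA ler_pM2l ?pi_gt0// ler_pdivrMr//.
by move: aq; rewrite natrM; lra.
Qed.

End nodes.

(** * The sum of bumps *)

Section bumps.
Context {R : realType}.
Implicit Types (i j n : nat) (e h t nu : R) (D : set R).
Local Notation mu := (@lebesgue_measure R).
Local Notation node := (@node R).

(** The radii are nodes too, so both sines in the integral of a bump obey the same low/high
    dichotomy. Doubling the index leaves about half of the low nodes with a high radius; these yield
    the growth. *)
Definition radius i : R := node (2 * i).+1.

Definition mass i : R := (Num.sqrt i.+1%:R)^-1.

Definition bump_support i : set R := `[node i - radius i, node i + radius i].

(** The height makes the integral equal to [2 * mass i], whatever the radius. *)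
Definition bump i t : R := mass i / radius i * \1_(bump_support i) t.

Definition comb n t : R := \sum_(i < n) bump i t.

Definition weight t : R := limn (comb ^~ t).

Lemma radius_gt0 i : 0 < radius i.
Proof. exact: node_gt0. Qed.

Lemma radius_le i : radius i <= node i / 2.
Proof. by apply: node_lt_half; lia. Qed.

Lemma mass_gt0 i : 0 < mass i.
Proof. by rewrite invr_gt0 sqrtr_gt0. Qed.

Lemma mass_le i j : (i <= j)%N -> mass j <= mass i.
Proof. by move=> ij; rewrite lef_pV2 ?posrE ?sqrtr_gt0// ler_wsqrtr// ler_nat. Qed.

Lemma mass_le1 i : mass i <= 1.
Proof. by rewrite (le_trans (mass_le (leq0n i)))// /mass sqrtr1 invr1. Qed.

Lemma mass_small e : 0 < e -> exists i, mass i <= e.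
Proof.
move=> e0; have [N eN] : exists N : nat, e^-1 ^+ 2 < N%:R.
  by exists (Num.bound (e^-1 ^+ 2)); rewrite archi_boundP// sqr_ge0.
exists N; rewrite /mass invf_ple ?posrE ?sqrtr_gt0//.
have -> : e^-1 = Num.sqrt (e^-1 ^+ 2) by rewrite sqrtr_sqr ger0_norm// invr_ge0 ltW.
by rewrite ler_wsqrtr// ltW// (lt_trans eN)// ltr_nat.
Qed.

Lemma height_ge0 i : 0 <= mass i / radius i.
Proof. by rewrite ltW// divr_gt0 ?mass_gt0 ?radius_gt0. Qed.

Lemma bump_ge0 i t : 0 <= bump i t.
Proof. by rewrite mulr_ge0 ?height_ge0// indicE. Qed.

Lemma bump_eq0 i t : (t < node i / 2) || (2 * node i < t) -> bump i t = 0.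
Proof.
have := node_gt0 i; have := radius_le i => ri ni ti.
rewrite /bump indicE memNset ?mulr0// /bump_support/= in_itv/= => /andP[t1 t2].
by case/orP: ti => ?; lra.
Qed.

Lemma measurable_bump D i : measurable_fun D (bump i).
Proof.
by apply: measurable_funM => //; apply: measurable_indic; exact: measurable_itv.
Qed.

Lemma measurable_comb D n : measurable_fun D (comb n).
Proof. by apply: measurable_sum => i; exact: measurable_bump. Qed.

Lemma comb_ge0 n t : 0 <= comb n t.
Proof. by apply: sumr_ge0 => i _; exact: bump_ge0. Qed.

Lemma comb_le n m t : (n <= m)%N -> comb n t <= comb m t.
Proof.
move=> nm; rewrite /comb -!(big_mkord xpredT (bump ^~ t)) (big_cat_nat _ nm)//=.
by rewrite lerDl sumr_ge0// => i _; exact: bump_ge0.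
Qed.

Lemma comb_stable n m t : 2 * node n < t -> (n <= m)%N -> comb m t = comb n t.
Proof.
move=> nt nm; rewrite /comb -!(big_mkord xpredT (bump ^~ t)) (big_cat_nat _ nm)//=.
rewrite [X in _ + X]big_nat_cond [X in _ + X]big1 ?addr0// => i /andP[/andP[ni _] _].
by rewrite bump_eq0//; have nin := @node_le R _ _ ni; apply/orP; right; lra.
Qed.

Lemma comb_le0 n t : t <= 0 -> comb n t = 0.
Proof.
move=> t0; apply: big1 => i _; rewrite bump_eq0//; apply/orP; left.
by have := @node_gt0 R i; lra.
Qed.

Lemma comb_cvg_stable n t : 2 * node n < t -> comb ^~ t @ \oo --> comb n t.
Proof.
by move=> nt; apply: cvg_near_cst; exists n => // m /= nm; exact: comb_stable.
Qed.

Lemma weight_stable n t : 2 * node n < t -> weight t = comb n t.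
Proof. by move=> nt; apply/cvg_lim => //; exact: comb_cvg_stable. Qed.

(** For t > 0 the sequence is constant once [2 * node n < t], since later bumps lie to the left of
    t; for t <= 0 every bump vanishes. *)
Lemma comb_cvg t : comb ^~ t @ \oo --> weight t.
Proof.
have [t0|t0] := leP t 0.
  have -> : comb ^~ t = cst 0 by apply/funext => n; rewrite comb_le0.
  rewrite /weight; have -> : comb ^~ t = cst 0 by apply/funext => n; rewrite comb_le0.
  by rewrite lim_cst//; exact: cvg_cst.
have [n nt] := @node_cvg0 R _ (divr_gt0 t0 (ltr0n _ 2)).
by rewrite (@weight_stable n); [apply: comb_cvg_stable|]; lra.
Qed.

Lemma weight_le0 t : t <= 0 -> weight t = 0.
Proof.
move=> t0; apply/cvg_lim => //.
have -> : comb ^~ t = cst 0 by apply/funext => n; rewrite comb_le0.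
exact: cvg_cst.
Qed.

Lemma comb_le_weight n t : comb n t <= weight t.
Proof.
rewrite -(cvg_lim _ (@comb_cvg t))//; apply: limr_ge; first exact: comb_cvg.
by exists n => // m /= nm; exact: comb_le.
Qed.

Lemma weight_ge0 t : 0 <= weight t.
Proof. exact: le_trans (comb_ge0 0 t) (comb_le_weight 0 t). Qed.

Lemma weight_gt1 t : 1 < t -> weight t = 0.
Proof.
move=> t1; rewrite (@weight_stable 0) ?/comb ?big_ord0//.
by have := @node0_le R; lra.
Qed.

Lemma measurable_weight D : measurable_fun D weight.
Proof.
by apply: (@measurable_fun_cvg _ _ _ _ comb) => [n|t _];
  [exact: measurable_comb|exact: comb_cvg].
Qed.

Lemma weightM_ge0 t : 0 <= weight t * t.
Proof.
have [t0|t0] := leP t 0; first by rewrite weight_le0// mul0r.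
by rewrite mulr_ge0 ?weight_ge0// ltW.
Qed.

Lemma combM_ge0 n t : 0 <= comb n t * t.
Proof.
have [t0|t0] := leP t 0; first by rewrite comb_le0// mul0r.
by rewrite mulr_ge0 ?comb_ge0// ltW.
Qed.

Lemma bumpM_ge0 i t : 0 <= bump i t * t.
Proof.
have [t0|t0] := leP t 0; last by rewrite mulr_ge0 ?bump_ge0// ltW.
by rewrite bump_eq0 ?mul0r//; have i0 := @node_gt0 R i; apply/orP; left; lra.
Qed.

(** On the support t is at most [2 * node i], and the bump has integral [2 * mass i]. The support
    starts at or after [node i / 2], so it misses [D] when [node i >= 2 * h]. *)
Lemma integral_bump_le D h i : measurable D -> (forall t, D t -> t < h) ->
  (\int[mu]_(t in D) (bump i t * t)%:E <=
   (if (node i < 2 * h)%R then 4 * (mass i * node i) else 0)%:E)%E.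
Proof.
move=> mD Dh; case: ifPn => [_|]; last first.
  rewrite -leNgt => hi; rewrite integral0_eq// => t /Dh th.
  by rewrite bump_eq0 ?mul0r//; apply/orP; left; lra.
have mS : measurable (bump_support i) by exact: measurable_itv.
have c0 : 0 <= mass i / radius i * (2 * node i).
  by rewrite mulr_ge0 ?height_ge0// mulr_ge0// ltW// node_gt0.
apply: (@le_trans _ _
  (\int[mu]_(t in D) ((mass i / radius i * (2 * node i))%:E *
                      (\1_(bump_support i) t)%:E))%E).
  apply: ge0_le_integral => //=.
  - by move=> t _; rewrite lee_fin bumpM_ge0.
  - apply/measurable_EFinP; apply: measurable_funM => //.
    exact: measurable_bump.
  - apply: emeasurable_funM => //; apply/measurable_EFinP.
    exact: measurable_indic.
  - move=> t _; rewrite -EFinM lee_fin /bump.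
    rewrite indicE; case: (boolP (t \in _)) => [|_]; last by rewrite !mulr0 mul0r.
    rewrite inE /bump_support/= in_itv/= => /andP[_ ti]; rewrite !mulr1 ler_wpM2l ?height_ge0//.
    by have := radius_le i; have := @node_gt0 R i; lra.
rewrite ge0_integralZl_EFin//; last first.
  by apply/measurable_EFinP; exact: measurable_indic.
rewrite integral_indic//.
apply: (@le_trans _ _ ((mass i / radius i * (2 * node i))%:E * mu (bump_support i))%E).
  by rewrite lee_wpmul2l ?lee_fin// le_measure ?inE//; exact: measurableI.
rewrite lebesgue_measure_itv/= lte_fin ifT; last by have := radius_gt0 i; lra.
rewrite -EFinB -EFinM lee_fin le_eqVlt; apply/orP; left; apply/eqP.
by field; rewrite gt_eqF// radius_gt0.
Qed.

(** By monotone convergence the integral is estimated bump by bump: each contributes at most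
    [4 * e * node i], and the nodes below [2 * h] sum to at most [4 * h]. It serves with e = 1 for
    integrability and with small e for the Lebesgue point. *)
Lemma integral_weight_le D h e : 0 <= h -> 0 <= e ->
  measurable D -> (forall t, D t -> t < h) ->
  (forall i, node i < 2 * h -> mass i <= e) ->
  (\int[mu]_(t in D) (weight t * t)%:E <= (16 * (e * h))%:E)%E.
Proof.
move=> h0 e0 mD Dh he.
have mcomb n : measurable_fun D (fun t => (comb n t * t)%:E).
  by apply/measurable_EFinP; apply: measurable_funM => //; exact: measurable_comb.
have -> : (\int[mu]_(t in D) (weight t * t)%:E =
    \int[mu]_(t in D) limn (fun n => (comb n t * t)%:E))%E.
  apply: eq_integral => t _; apply/esym/cvg_lim => //.
  by apply: cvg_EFin; [near=> n|apply: cvgMl; exact: comb_cvg].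
have comb_mono t : D t -> {homo (fun n => (comb n t * t)%:E) : n m / (n <= m)%N >-> (n <= m)%E}.
  move=> _ n m nm; rewrite lee_fin; have [t0|t0] := leP t 0.
    by rewrite !comb_le0// mul0r.
  by rewrite ler_wpM2r ?comb_le// ltW.
rewrite monotone_convergence//; last by move=> n t _; rewrite lee_fin combM_ge0.
apply: lime_le.
  apply: ereal_nondecreasing_is_cvgn => n m nm; apply: ge0_le_integral => //.
  - by move=> t _; rewrite lee_fin combM_ge0.
  - exact: mcomb.
  - exact: mcomb.
  - by move=> t Dt; apply: (comb_mono t Dt).
near=> n.
have -> : (\int[mu]_(t in D) (comb n t * t)%:E =
    \sum_(i < n) \int[mu]_(t in D) (bump i t * t)%:E)%E.
  rewrite -ge0_integral_sum//; last 2 first.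
  - move=> i; apply/measurable_EFinP; apply: measurable_funM => //.
    exact: measurable_bump.
  - by move=> i t _; rewrite lee_fin bumpM_ge0.
  by apply: eq_integral => t _; rewrite sumEFin /comb mulr_suml.
apply: (@le_trans _ _ (\sum_(i < n)
    (if node i < 2 * h then 4 * (mass i * node i) else 0)%:E)%E).
  by apply: lee_sum => i _; exact: integral_bump_le.
rewrite sumEFin lee_fin -big_mkcond/=.
apply: (@le_trans _ _ (\sum_(i < n | node i < 2 * h) 4 * e * node i)).
  apply: ler_sum => i ih; rewrite -mulrA ler_pM2l// ler_wpM2r ?he//.
  by rewrite ltW ?node_gt0.
rewrite -mulr_sumr; have := @sum_node_lt R (2 * h) n; nra.
Unshelve. all: by end_near. Qed.

End bumps.

(** * Integrals of the weight against sines *)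

Section weight_integral.
Context {R : realType}.
Implicit Types (i j n : nat) (e h t nu : R) (D : set R).
Local Notation mu := (@lebesgue_measure R).
Local Notation node := (@node R).
Local Notation weight := (@weight R).
Local Notation mass := (@mass R).
Local Notation radius := (@radius R).
Local Notation torus := [set` (`[- pi, pi] : interval R)].

Lemma measurable_sinM D nu : measurable_fun D (fun t => sin (nu * t)).
Proof.
apply: (measurableT_comp (f := @sin R)).
  by apply: continuous_measurable_fun; exact: continuous_sin.
by apply: measurable_funM.
Qed.

Lemma integrable_weightM : mu.-integrable torus (fun t => (weight t * t)%:E).
Proof.
apply/integrableP; split.
  by apply/measurable_EFinP; apply: measurable_funM => //; exact: measurable_weight.
under eq_integral do rewrite abse_EFin ger0_norm ?weightM_ge0//.
(* The bound [pi + 1] is strict on the closed interval, and all masses are at most 1. *)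
apply: (@le_lt_trans _ _ (16 * (1 * (pi + 1)))%:E); last exact: ltry.
have := @pi_ge0 R => pi0; apply: integral_weight_le => //; first lra.
  by move=> t /=; rewrite in_itv/= => /andP[_]; lra.
by move=> i _; exact: mass_le1.
Qed.

(** The masses are not summable, so [weight] alone is not integrable; a factor of order t at the
    origin restores integrability. Only t > 0 matters because the weight vanishes elsewhere. *)
Lemma integrable_weight_dominated (g : R -> R) (c : R) :
  measurable_fun torus g -> (forall t, 0 < t -> `|g t| <= c * t) ->
  mu.-integrable torus (fun t => (weight t * g t)%:E).
Proof.
move=> mg gc; apply: (@le_integrable _ _ _ mu torus _ _
    (fun t => c%:E * (weight t * t)%:E)%E) => //.
- by apply/measurable_EFinP; apply: measurable_funM => //; exact: measurable_weight.
- move=> t _; rewrite -EFinM !abse_EFin lee_fin; have [t0|t0] := leP t 0.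
    by rewrite weight_le0// !mul0r mulr0.
  by rewrite !normrM mulrCA ler_wpM2l// (le_trans (gc _ t0))// -normrM ler_norm.
- by apply: integrableZl => //; exact: integrable_weightM.
Qed.

Lemma norm_sinM_le nu t : 0 < nu -> 0 < t -> `|sin (nu * t)| <= nu * t.
Proof. by move=> nu0 t0; rewrite sin_le_id// mulr_ge0// ltW. Qed.

Lemma integrable_weight_sin nu : 0 < nu ->
  mu.-integrable torus (fun t => (weight t * sin (nu * t))%:E).
Proof.
move=> nu0; apply: (@integrable_weight_dominated _ nu) => [|t t0].
  exact: measurable_sinM.
exact: norm_sinM_le.
Qed.

Lemma integrable_indic_sin D nu : measurable D ->
  mu.-integrable torus (fun t => (\1_D t * sin (nu * t))%:E).
Proof.
move=> mD; apply: (@le_integrable _ _ _ mu torus _ _ (fun t => (sin (nu * t))%:E)) => //.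
- apply/measurable_EFinP; apply: measurable_funM; first exact: measurable_indic.
  exact: measurable_sinM.
- move=> t _; rewrite !abse_EFin lee_fin normrM ler_piMl//.
  by rewrite indicE normr_nat lern1 leq_b1.
- apply: continuous_compact_integrable; first exact: segment_compact.
  apply: continuous_subspaceT => t; apply: continuous_comp; last exact: continuous_sin.
  exact: mulrl_continuous.
Qed.

Lemma integrable_bump_sin i nu :
  mu.-integrable torus (fun t => (bump i t * sin (nu * t))%:E).
Proof.
rewrite (_ : (fun _ => _) = fun t => ((mass i / radius i)%:E *
    (\1_(bump_support i) t * sin (nu * t))%:E)%E); last first.
  by apply/funext => t; rewrite -EFinM mulrA.
by apply: integrableZl => //; apply: integrable_indic_sin; exact: measurable_itv.
Qed.

Lemma bump_support_sub i : bump_support i `<=` torus.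
Proof.
move=> t; rewrite /bump_support/= !in_itv/= => /andP[t1 t2].
have := @pi_ge2 R; have := @node0_le R; have := @node_le R _ _ (leq0n i).
have := @radius_le R i; have := @radius_gt0 R i; have := @node_gt0 R i => *; apply/andP; split; lra.
Qed.

Lemma integral_bump_sin i nu : 0 < nu ->
  (\int[mu]_(t in torus) (bump i t * sin (nu * t)%R)%:E =
   (mass i / radius i *
     (2 / nu * (sin (nu * node i) * sin (nu * radius i))))%:E)%E.
Proof.
move=> nu0; rewrite EFinM -integral_sin_sym ?radius_gt0//.
have -> : [set` `[node i - radius i, node i + radius i]] = torus `&` bump_support i.
  by rewrite setIidr//; exact: bump_support_sub.
rewrite integral_mkcondr.
rewrite -integralZl//; last first.
  rewrite (_ : _ \_ _ = fun t => (\1_(bump_support i) t * sin (nu * t))%:E).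
    by apply: integrable_indic_sin; exact: measurable_itv.
  apply/funext => t; rewrite patchE indicE.
  by case: ifPn => _; rewrite ?mul1r ?mul0r.
apply: eq_integral => t _; rewrite patchE /bump indicE.
by case: ifPn => _; rewrite ?mulr1 ?mulr0 ?mul0r ?mule0// EFinM.
Qed.

(** Dropping the bumps from index n on can only lower the integral: they vanish beyond [2 * node n],
    and up to there the sine is nonnegative for t > 0. *)
Lemma weight_sin_ge n nu : 0 < nu -> nu * (2 * node n) <= pi ->
  \sum_(i < n) mass i / radius i *
     (2 / nu * (sin (nu * node i) * sin (nu * radius i))) <=
  \int[mu]_(t in torus) (weight t * sin (nu * t)).
Proof.
move=> nu0 nupi.
have int_comb : (\int[mu]_(t in torus) (comb n t * sin (nu * t)%R)%:E =
  (\sum_(i < n) mass i / radius i *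
     (2 / nu * (sin (nu * node i) * sin (nu * radius i))))%:E)%E.
  rewrite -sumEFin; under eq_bigr do rewrite -integral_bump_sin//.
  rewrite -integral_sum//; last by move=> i; exact: integrable_bump_sin.
  by apply: eq_integral => t _; rewrite sumEFin /comb mulr_suml.
rewrite -[leLHS]/(fine (_%:E)) -int_comb; apply: le_Rintegral => //.
- rewrite (_ : _ \o _ = fun t => (\sum_(i < n) (bump i t * sin (nu * t))%:E)%E).
    by apply: integrable_sum => // i _; exact: integrable_bump_sin.
  by apply/funext => t /=; rewrite sumEFin /comb mulr_suml.
- exact: integrable_weight_sin.
- move=> t _; have [tn|tn] := ltP (2 * node n) t; first by rewrite (weight_stable tn).
  have [t0|t0] := leP t 0; first by rewrite comb_le0// weight_le0.
  rewrite ler_wpM2r ?comb_le_weight//; apply: sin_ge0_pi.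
  apply/andP; split; first by rewrite mulr_ge0// ltW.
  by apply: le_trans nupi; rewrite ler_wpM2l// ltW.
Qed.

Lemma norm_sin_node_le nu i : 0 < nu -> `|sin (nu * node i)| <= nu * node i.
Proof. by move=> nu0; apply: norm_sinM_le => //; exact: node_gt0. Qed.

(** Pair i with n - i: at least one of the two satisfies the inequality. *)
Lemma sum_half n : \sum_(i < n.+1) (n <= 2 * i)%N%:R >= n.+1%:R / 2 :> R.
Proof.
set S := \sum_(i < n.+1) _.
have : n.+1%:R <= S + S; last lra.
rewrite {2}/S (reindex_inj rev_ord_inj) -big_split/= -[leLHS]mulr1.
rewrite -[n.+1 in leLHS]card_ord mulr_natl -sumr_const ler_sum// => i _.
rewrite -natrD ler1n; have := ltn_ord i; lia.
Qed.

(* The only terms without a favourable sign are those in which the node or the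
   radius is [node n]; each of them is at least [-2]. *)
Lemma node_sum_ge nu n : 0 < nu ->
  (forall i, (i < n)%N -> sin (nu * node i) = 1) ->
  (forall i, (n < i)%N -> nu * node i <= pi / 4) ->
  Num.sqrt n.+1%:R / 2 - 5 <=
  \sum_(i < n.+1) mass i / radius i *
     (2 / nu * (sin (nu * node i) * sin (nu * radius i))).
Proof.
move=> nu0 low high.
have term_abs i s : `|s| <= nu * radius i -> - 2 <= mass i / radius i * (2 / nu * s).
  move=> sr; have r0 := @radius_gt0 R i.
  have -> : mass i / radius i * (2 / nu * s) = 2 * (mass i * (s / (nu * radius i))).
    by field; rewrite !gt_eqF.
  have : `|mass i * (s / (nu * radius i))| <= 1.
    have q1 : `|s / (nu * radius i)| <= 1.
      rewrite normrM normfV (gtr0_norm (mulr_gt0 nu0 r0)).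
      by rewrite ler_pdivrMr ?mul1r// mulr_gt0.
    by rewrite normrM (gtr0_norm (mass_gt0 i)) mulr_ile1 ?mass_le1// ltW ?mass_gt0.
  by rewrite ler_norml => /andP[]; lra.
(* For i < n the first sine is 1. If 2 i + 1 < n the second is 1 as well; if 2 i + 1 > n it is at
   least half its argument, so the term is at least [mass i]; if 2 i + 1 = n only the bound -2 is
   left. At i = n the 3 covers this bound together with [mass n <= 1]. *)
have term_ge (i : 'I_n.+1) : mass n * (n <= 2 * i)%N%:R - 2 * ((2 * i).+1 == n)%:R -
    3 * (i == n :> nat)%:R <=
    mass i / radius i * (2 / nu * (sin (nu * node i) * sin (nu * radius i))).
  have := @mass_gt0 R n; have := @mass_le1 R n => mn1 mn0.
  have := ltn_ord i; rewrite ltnS leq_eqVlt => /predU1P[in_|i_lt].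
    have : - 2 <= mass i / radius i * (2 / nu * (sin (nu * node i) * sin (nu * radius i))).
      apply: term_abs; rewrite normrM; apply: le_trans (norm_sin_node_le _ nu0).
      by rewrite ler_piMl// sin_max.
    rewrite in_ eqxx; case: (n <= _)%N; case: (_ == n) => /=; lra.
  rewrite low// mul1r (ltn_eqF i_lt).
  have [i2|i2|i2] := ltngtP (2 * i).+1 n.
  - have -> : (n <= 2 * i)%N = false by lia.
    by rewrite low//= mulr1 !mulr0 !subr0 mulr_ge0 ?height_ge0// ltW// divr_gt0.
  - have -> : (n <= 2 * i)%N by lia.
    have nur : nu * radius i / 2 <= sin (nu * radius i).
      by apply: sin_ge_half; rewrite high// mulr_ge0// ltW// node_gt0.
    rewrite /= mulr1 !mulr0 !subr0.
    apply: (@le_trans _ _ (mass i)); first by apply: mass_le; exact: ltnW.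
    have r0 := @radius_gt0 R i.
    have {1}-> : mass i = mass i / radius i * (2 / nu * (nu * radius i / 2)).
      by field; rewrite !gt_eqF.
    by rewrite ler_wpM2l ?height_ge0// ler_wpM2l// ltW// divr_gt0.
  - have -> : (n <= 2 * i)%N = false by lia.
    by have := term_abs i (sin (nu * radius i)) (norm_sin_node_le _ nu0); rewrite /=; lra.
apply: (@le_trans _ _ (\sum_(i < n.+1) (mass n * (n <= 2 * i)%N%:R -
    2 * ((2 * i).+1 == n)%:R - 3 * (i == n :> nat)%:R))); last first.
  by apply: ler_sum => i _; exact: term_ge.
rewrite !sumrB -!mulr_sumr.
have at_most_one (P : pred 'I_n.+1) : (forall i j : 'I_n.+1, P i -> P j -> i = j) ->
    \sum_(i < n.+1) (P i)%:R <= 1 :> R.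
  move=> Pinj; have [i Pi|P0] := pickP P; last by rewrite big1// => i _; rewrite P0.
  rewrite (bigD1 i)//= Pi big1 ?addr0// => j ji.
  by case: (boolP (P j)) => // Pj; rewrite (Pinj j i) ?eqxx in ji.
have a1 : \sum_(i < n.+1) ((2 * i).+1 == n)%:R <= 1 :> R.
  by apply: at_most_one => i j /eqP ? /eqP ?; apply/val_inj => /=; lia.
have b1 : \sum_(i < n.+1) (i == n :> nat)%:R <= 1 :> R.
  by apply: at_most_one => i j /eqP ? /eqP ?; apply/val_inj => /=; lia.
have : Num.sqrt n.+1%:R / 2 <= mass n * \sum_(i < n.+1) (n <= 2 * i)%N%:R.
  apply: (@le_trans _ _ (mass n * (n.+1%:R / 2))).
    have s0 : 0 < Num.sqrt n.+1%:R :> R by rewrite sqrtr_gt0.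
    have ss : Num.sqrt n.+1%:R * Num.sqrt n.+1%:R = n.+1%:R :> R.
      by rewrite -expr2 sqr_sqrtr.
    by rewrite mulrA ler_pM2r// -[n.+1%:R in leRHS]ss mulKf// gt_eqF.
  by rewrite ler_pM2l ?mass_gt0// sum_half.
by lra.
Qed.

End weight_integral.

(** * The function *)

Section bump_function.
Context {R : realType}.
Implicit Types (n k : nat) (e t : R) (D : set R).
Local Notation mu := (@lebesgue_measure R).
Local Notation weight := (@weight R).
Local Notation torus := [set` (`[- pi, pi] : interval R)].

Definition bump_fun t : R :=
  let s := t - (Num.floor (t / (pi *+ 2)))%:~R * (pi *+ 2) in
  weight s * sin (s / 2).

Lemma periodic_bump_fun : periodic bump_fun (pi *+ 2).
Proof.
have pi0 : pi *+ 2 != 0 :> R by rewrite gt_eqF// mulrn_wgt0// pi_gt0.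
move=> t; rewrite /bump_fun mulrDl divff// floorDrz ?int_num1// floor1.
by rewrite intrD mulrDl mul1r opprD addrACA subrr addr0.
Qed.

Lemma bump_funE t : torus t -> bump_fun t = weight t * sin (t / 2).
Proof.
have pi0 := @pi_gt0 R; have pi2 := @pi_ge2 R.
rewrite /= in_itv/= => /andP[t1 t2]; rewrite /bump_fun -[pi *+ 2]mulr_natr.
have [t0|t0] := leP 0 t.
  rewrite (@floor_def _ _ 0) ?mul0r ?subr0// add0r.
  by rewrite ler_pdivlMr ?mulr_gt0// ltr_pdivrMr ?mulr_gt0// mul0r t0/=; lra.
(* For t < 0 the representative is t + 2 pi >= pi > 1, where the weight vanishes, as it does at t
   itself. *)
rewrite (@floor_def _ _ (-1)); last first.
  by rewrite addNr ler_pdivlMr ?mulr_gt0// ltr_pdivrMr ?mulr_gt0//; apply/andP; split; lra.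
by rewrite weight_gt1 ?mul0r ?weight_le0 ?mul0r//; lra.
Qed.

Lemma bump_fun0 : bump_fun 0 = 0.
Proof.
rewrite bump_funE ?weight_le0 ?mul0r//=.
by rewrite in_itv/= oppr_le0 pi_ge0.
Qed.

Lemma norm_bump_fun_le t : torus t -> `|bump_fun t| <= weight t * t.
Proof.
move=> /bump_funE ->; have [t0|t0] := leP t 0; first by rewrite weight_le0// !mul0r normr0.
rewrite normrM (ger0_norm (weight_ge0 t)) ler_wpM2l ?weight_ge0//.
by rewrite (le_trans (sin_le_id _)); lra.
Qed.

Lemma measurable_bump_fun D : D `<=` torus -> measurable D -> measurable_fun D bump_fun.
Proof.
move=> Dt mD; apply: (@eq_measurable_fun _ _ _ _ _ (fun t => weight t * sin (2^-1 * t))).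
  by move=> t /set_mem /Dt /bump_funE ->; rewrite (mulrC t).
by apply: measurable_funM; [exact: measurable_weight|exact: measurable_sinM].
Qed.

Lemma L1_bump_fun : L1_torus bump_fun.
Proof.
split; first exact: periodic_bump_fun.
have sub : `[- pi, pi[ `<=` torus by exact: subset_itv_co_cc.
apply: (@le_integrable _ _ _ mu _ _ _ (fun t => (weight t * t)%:E)) => //.
- by apply/measurable_EFinP; exact: measurable_bump_fun.
- move=> t /sub tD; rewrite /= lee_fin (le_trans (norm_bump_fun_le tD))//.
  exact: ler_norm.
- by apply: (@integrableS _ _ _ mu torus) => //; exact: integrable_weightM.
Qed.

Lemma dirichlet_bump_fun n t : torus t ->
  bump_fun (0 + t) * dirichlet_kernel n t = weight t * sin ((n%:R + 2^-1) * t).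
Proof.
move=> tD; rewrite add0r (bump_funE tD) /dirichlet_kernel.
have [t0|t0] := leP t 0; first by rewrite weight_le0// !mul0r.
have [t1|t1] := ltP 1 t; first by rewrite weight_gt1// !mul0r.
(* Only 0 < t <= 1 remains, where the kernel is given by its quotient branch. *)
have s0 : 0 < sin (t / 2).
  by apply: sin_gt0_pi; have := @pi_ge2 R; move=> ?; apply/andP; split; lra.
by rewrite gt_eqF// -mulrA [_ * (_ / _)]mulrC divfK// gt_eqF.
Qed.

Lemma fourier_bump_fun n : fourier_partial_sum n bump_fun 0 =
  (2 * pi)^-1 * \int[mu]_(t in torus) (weight t * sin ((n%:R + 2^-1) * t)).
Proof.
congr (_ * _); apply: eq_Rintegral => t /set_mem tD.
exact: dirichlet_bump_fun.
Qed.

Lemma fourier_bump_fun_ge k : (0 < k)%N ->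
  (2 * pi)^-1 * (Num.sqrt (level k).+1%:R / 2 - 5) <=
  fourier_partial_sum (sparse_seq k) bump_fun 0.
Proof.
move=> k0; rewrite fourier_bump_fun; set nu := _ + 2^-1.
have nu0 : 0 < nu by rewrite ltr_wpDl// invr_gt0.
have high := @node_high R _ _ k0.
rewrite ler_wpM2l ?invr_ge0 ?mulr_ge0 ?pi_ge0//.
(* The bump of index [level k], neither low nor high, is kept; the first dropped node is high, so
   twice it times [nu] is at most pi / 2. *)
apply: le_trans (@weight_sin_ge R (level k).+1 nu nu0 _).
  by apply: node_sum_ge => // i; exact: sin_node_low.
by have := high _ (ltnSn _); rewrite -/nu [nu * (2 * _)]mulrCA; have := @pi_ge0 R; lra.
Qed.

(** A bump meeting a small ball has a large index, hence a small mass: once [2 * r <= node i0], only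
    indices from [i0] on matter, with masses at most [e / 16]. This cancels the 16 of
    [integral_weight_le]. *)
Lemma integral_bump_fun_ball (e : R) : 0 < e ->
  \forall r \near (0:R)^'+, (\int[mu]_(t in ball (0%R : R) r) `|bump_fun t|%:E <= (e * r)%:E)%E.
Proof.
move=> e0; have e16 : 0 < e / 16 by rewrite divr_gt0.
have [i0 mi0] := @mass_small R _ e16.
near=> r; have r0 : 0 < r by near: r; exact: nbhs_right_gt.
have r1 : r <= 1 by near: r; exact: nbhs_right_le.
have rn : 2 * r <= @node R i0.
  suff : r <= @node R i0 / 2 by lra.
  by near: r; apply: nbhs_right_le; rewrite divr_gt0// node_gt0.
have sub : ball (0 : R) r `<=` torus.
  move=> t; rewrite ball_itv/= !in_itv/= sub0r add0r => /andP[tr1 tr2].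
  by have := @pi_ge2 R => ?; apply/andP; split; lra.
have mB : measurable (ball (0 : R) r) by exact: measurable_ball.
apply: (@le_trans _ _ (\int[mu]_(t in ball (0%R : R) r) (weight t * t)%:E)%E).
  apply: ge0_le_integral => //.
  - apply/measurable_EFinP; apply: measurableT_comp => //.
    exact: measurable_bump_fun.
  - by apply/measurable_EFinP; apply: measurable_funM => //; exact: measurable_weight.
  - by move=> t /sub tD; rewrite lee_fin norm_bump_fun_le.
have -> : e * r = 16 * (e / 16 * r) by field.
apply: (integral_weight_le (ltW r0) (ltW e16) mB).
- by move=> t; rewrite ball_itv/= in_itv/= !add0r => /andP[].
- move=> i ir; apply: le_trans mi0; apply: mass_le; rewrite leqNgt; apply/negP => ii0.
  have := @node_le R _ _ (ltnW ii0); lra.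
Unshelve. all: by end_near. Qed.

Lemma lebesgue_pt_bump_fun : lebesgue_pt bump_fun 0.
Proof.
have davg_le (e : R) : 0 < e -> \forall r \near (0:R)^'+, (davg bump_fun 0 r <= e%:E)%E.
  move=> e0; near=> r; have r0 : 0 < r by near: r; exact: nbhs_right_gt.
  rewrite /davg /iavg lebesgue_measure_ball ?(ltW r0)// bump_fun0.
  rewrite inver mulrn_eq0/= gt_eqF// lee_pdivrMl ?mulrn_wgt0//.
  under eq_integral do rewrite /= subr0.
  apply: (@le_trans _ _ (e * r)%:E).
    by near: r; exact: integral_bump_fun_ball.
  by rewrite -EFinM lee_fin mulr2n; nra.
apply/fine_cvgP; split.
  near=> r; rewrite ge0_fin_numE ?davg_ge0//.
  by apply: (@le_lt_trans _ _ 1%:E); [near: r; exact: davg_le|exact: ltry].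
apply/cvgrPdist_le => e e0; near=> r.
have dr : (davg bump_fun 0 r <= e%:E)%E by near: r; exact: davg_le.
rewrite sub0r normrN ger0_norm ?fine_ge0 ?davg_ge0// -lee_fin fineK//.
by rewrite ge0_fin_numE ?davg_ge0// (le_lt_trans dr)// ltry.
Unshelve. all: by end_near. Qed.

End bump_function.

(** * Unboundedness of the Cesaro means and conclusion *)

Lemma cesaro_unbounded (R : realType) (s : nat -> R) (c : R) :
  (forall k, (0 < k)%N -> c <= s k) ->
  (forall A, exists K, forall k, (K <= k)%N -> A <= s k) ->
  ereal_sup [set (`| m%:R^-1 * \sum_(1 <= k < m.+1) s k |)%:E
            | m in [set m : nat | (1 <= m)%N]] = +oo%E.
Proof.
(* In the mean of 2 N terms the first N are at least c and the last N at least [2 * A + |c|], so the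
   mean is at least A. *)
move=> sc sK; apply/eqyP => A A0; have [K AK] := sK (2 * A + `|c|).
set N := K.+1; have N0 : 0 < N%:R :> R by rewrite ltr0n.
apply: le_trans (ereal_sup_ubound _); last by exists (N + N)%N.
rewrite lee_fin; apply: le_trans (ler_norm _).
rewrite (@big_cat_nat _ _ _ N.+1)//=; last by rewrite ltnS leq_addr.
have head : c * N%:R <= \sum_(1 <= k < N.+1) s k.
  rewrite mulr_natr -[N in c *+ N](subn1 N.+1) -sumr_const_nat.
  by apply: ler_sum_nat => k /andP[k0 _]; exact: sc.
have tail : (2 * A + `|c|) * N%:R <= \sum_(N.+1 <= k < (N + N).+1) s k.
  rewrite mulr_natr -[N in _ *+ N](addKn N.+1 N) addSn -sumr_const_nat.
  by apply: ler_sum_nat => k /andP[kN _]; apply: AK; rewrite ltnW// ltnW.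
rewrite ler_pdivlMl ?natrD ?addr_gt0//.
have := ler_norm (- c); rewrite normrN; nra.
Qed.

Unset Implicit Arguments.

Theorem theorem1 (R : realType) :
  exists (a : nat -> nat) (f : R -> R),
    (forall m : nat, (1 <= m)%N -> (0 < a m)%N) /\
    strictly_increasing a /\
    strictly_convex a /\
    L1_torus f /\
    (forall m : nat, (1 <= m)%N -> (a m <= 7 * m ^ 8)%N) /\
    (lebesgue_pt f 0 /\ f 0 = 0) /\
    ereal_sup [set (`| m%:R^-1 *
                  \sum_(1 <= k < m.+1) fourier_partial_sum (a k) f 0 |)%:E
              | m in [set m : nat | (1 <= m)%N]] = +oo%E.
Proof.
exists sparse_seq, bump_fun; split.
  by case=> // m _; apply: leq_ltn_trans (sparse_seq_ltS m).
split; first by move=> m _; exact: sparse_seq_ltS.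
split.
  move=> m _; rewrite /difference; have := sparse_step_ltS m.+1.
  by have := sparse_stepE m.+1; have := sparse_stepE m; lia.
split; first exact: L1_bump_fun.
split.
  move=> m m1; apply: leq_trans (sparse_seq_le m) _.
  by rewrite leq_mul// leq_pexp2l.
split; first by split; [exact: lebesgue_pt_bump_fun|exact: bump_fun0].
have pi0 : 0 < 2 * pi :> R by rewrite mulr_gt0// pi_gt0.
apply: (@cesaro_unbounded _ _ ((2 * pi)^-1 * - 5)) => [k k0|A].
  apply: le_trans (fourier_bump_fun_ge k0).
  by rewrite ler_pM2l ?invr_gt0// lerDr divr_ge0// sqrtr_ge0.
(* Solving (2 pi)^-1 (x / 2 - 5) >= A for x gives x >= B. Indices from [5 ^ 4 ^ n] on have level at
   least n > B ^ 2, so x = [Num.sqrt (level k).+1%:R] qualifies. *)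
pose B := 2 * (2 * pi * A + 5).
have [n Bn] : exists n : nat, B ^+ 2 < n%:R.
  by exists (Num.bound (B ^+ 2)); rewrite archi_boundP// sqr_ge0.
exists (5 ^ 4 ^ n)%N => k nk; have k0 : (0 < k)%N by rewrite (leq_trans _ nk)// expn_gt0.
apply: le_trans (fourier_bump_fun_ge k0).
rewrite mulrC ler_pdivlMr// lerBrDr ler_pdivlMr//.
rewrite [X in X <= _](_ : _ = B); last by rewrite /B; ring.
apply: le_trans (ler_norm B) _; rewrite -sqrtr_sqr ler_wsqrtr// (le_trans (ltW Bn))//.
by rewrite ler_nat ltnW// ltnS level_expn.
Qed.
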